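(* Let $(A,\cdot,\{~,~\})$ be a Poisson algebra and $N:A\to A$ be a Nijenhuis operator on it. Define four bilinear operations $\ast,\curlyvee,\diamond,\bullet:A\times A\to A$ by $$x\ast y=N(x)\cdot y,\quad x\curlyvee y=-N(x\cdot y),\quad x\diamond y=\{N(x),y\},\quad x\bullet y=-N\{x,y\},\qquad x,y\in A.$$ Then $(A,\ast,\curlyvee,\diamond,\bullet)$ is an NS-Poisson algebra.
   Context: All vector spaces and (multi)linear maps are over a field $\mathbf{k}$ of characteristic $0$. Associative algebras are not required to be unital. A Poisson algebra is a triple $(A,\cdot,\{~,~\})$ with $(A,\cdot)$ a commutative associative algebra and $\{~,~\}$ a Lie bracket on $A$ satisfying $\{x,y\cdot z\}=\{x,y\}\cdot z+y\cdot\{x,z\}$. A Nijenhuis operator on a Poisson algebra $(A,\cdot,\{~,~\})$ is a linear map $N:A\to A$ such that for all $x,y\in A$: $$N(x)\cdot N(y)=N\big(N(x)\cdot y+x\cdot N(y)-N(x\cdot y)\big),\qquad \{N(x),N(y)\}=N\big(\{N(x),y\}+\{x,N(y)\}-N\{x,y\}\big).$$ An NS-commutative algebra is a triple $(A,\ast,\curlyvee)$ of a vector space $A$ with bilinear operations $\ast,\curlyvee$, where $\curlyvee$ is commutative, such that for all $x,y,z\in A$, with $x\odot y=x\ast y+y\ast x+x\curlyvee y$: $$x\ast(y\ast z)=(x\odot y)\ast z,\qquad x\ast(y\curlyvee z)+x\curlyvee(y\odot z)=y\ast(x\curlyvee z)+y\curlyvee(x\odot z).$$ An NS-Lie algebra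 is a triple $(A,\diamond,\bullet)$ of a vector space $A$ with bilinear operations $\diamond,\bullet$, where $\bullet$ is skew-symmetric, such that for all $x,y,z\in A$, with $\{\!\!\{x,y\}\!\!\}=x\diamond y-y\diamond x+x\bullet y$: $$x\diamond(y\diamond z)-(x\diamond y)\diamond z-y\diamond(x\diamond z)+(y\diamond x)\diamond z=(x\bullet y)\diamond z,$$ $$x\bullet\{\!\!\{y,z\}\!\!\}+y\bullet\{\!\!\{z,x\}\!\!\}+z\bullet\{\!\!\{x,y\}\!\!\}+x\diamond(y\bullet z)+y\diamond(z\bullet x)+z\diamond(x\bullet y)=0.$$ An NS-Poisson algebra is a quintuple $(A,\ast,\curlyvee,\diamond,\bullet)$ such that $(A,\ast,\curlyvee)$ is an NS-commutative algebra, $(A,\diamond,\bullet)$ is an NS-Lie algebra, and for all $x,y,z\in A$, with $x\odot y=x\ast y+y\ast x+x\curlyvee y$ and $\{\!\!\{x,y\}\!\!\}=x\diamond y-y\diamond x+x\bullet y$: $$\{\!\!\{x,y\}\!\!\}\ast z=x\diamond(y\ast z)-y\ast(x\diamond z),$$ $$(x\odot y)\diamond z=x\ast(y\diamond z)+y\ast(x\diamond z),$$ $$x\bullet(y\odot z)+x\diamond(y\curlyvee z)=\{\!\!\{x,y\}\!\!\}\curlyvee z+z\ast(x\bullet y)+y\curlyvee\{\!\!\{x,z\}\!\!\}+y\ast(x\bullet z).$$ *)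

(* Defs.v *)
From HB Require Import structures.
From mathcomp Require Import all_boot all_algebra.

Set Implicit Arguments.
Unset Strict Implicit.
Unset Printing Implicit Defensive.

Import GRing.Theory.
Local Open Scope ring_scope.

Section Definitions.

Variables (k : fieldType) (A : lmodType k).
Implicit Types (mul br ast cur dia bul : A -> A -> A) (N : {linear A -> A}).

(* [bilinear_for *:%R *:%R op] of mathcomp.algebra.sesquilinear, in Prop. *)
Definition is_bilinear (op : A -> A -> A) : Prop :=
  (forall y, linear (op^~ y)) /\ (forall x, linear (op x)).

Definition skew_symmetric (op : A -> A -> A) : Prop :=
  forall x y, op x y = - op y x.

Record is_comm_assoc_algebra mul : Prop := IsCommAssocAlgebra {
  cassoc_bilinear : is_bilinear mul;
  cassoc_comm : commutative mul;
  cassoc_assoc : associative mul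
}.

Record is_lie_bracket br : Prop := IsLieBracket {
  lie_bilinear : is_bilinear br;
  lie_skew : skew_symmetric br;
  lie_jacobi : forall x y z,
    br x (br y z) + br y (br z x) + br z (br x y) = 0
}.

Record is_poisson_algebra mul br : Prop := IsPoissonAlgebra {
  poisson_comm_assoc : is_comm_assoc_algebra mul;
  poisson_lie : is_lie_bracket br;
  poisson_leibniz : forall x y z,
    br x (mul y z) = mul (br x y) z + mul y (br x z)
}.

Record is_nijenhuis mul br N : Prop := IsNijenhuis {
  nijenhuis_mul : forall x y,
    mul (N x) (N y) = N (mul (N x) y + mul x (N y) - N (mul x y));
  nijenhuis_br : forall x y,
    br (N x) (N y) = N (br (N x) y + br x (N y) - N (br x y))
}.

Definition ns_odot ast cur (x y : A) : A := ast x y + ast y x + cur x y.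

Definition ns_bracket dia bul (x y : A) : A := dia x y - dia y x + bul x y.

Record is_ns_commutative_algebra ast cur : Prop := IsNSCommutativeAlgebra {
  nscomm_ast_bilinear : is_bilinear ast;
  nscomm_cur_bilinear : is_bilinear cur;
  nscomm_cur_comm : commutative cur;
  nscomm_ast_odot : forall x y z,
    ast x (ast y z) = ast (ns_odot ast cur x y) z;
  nscomm_cur_odot : forall x y z,
    ast x (cur y z) + cur x (ns_odot ast cur y z)
    = ast y (cur x z) + cur y (ns_odot ast cur x z)
}.

Record is_ns_lie_algebra dia bul : Prop := IsNSLieAlgebra {
  nslie_dia_bilinear : is_bilinear dia;
  nslie_bul_bilinear : is_bilinear bul;
  nslie_bul_skew : skew_symmetric bul;
  nslie_dia : forall x y z,
    dia x (dia y z) - dia (dia x y) z - dia y (dia x z) + dia (dia y x) z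
    = dia (bul x y) z;
  nslie_bul_bracket : forall x y z,
    bul x (ns_bracket dia bul y z) + bul y (ns_bracket dia bul z x)
    + bul z (ns_bracket dia bul x y)
    + dia x (bul y z) + dia y (bul z x) + dia z (bul x y) = 0
}.

Record is_ns_poisson_algebra ast cur dia bul : Prop := IsNSPoissonAlgebra {
  nspoisson_comm : is_ns_commutative_algebra ast cur;
  nspoisson_lie : is_ns_lie_algebra dia bul;
  nspoisson_bracket_ast : forall x y z,
    ast (ns_bracket dia bul x y) z = dia x (ast y z) - ast y (dia x z);
  nspoisson_odot_dia : forall x y z,
    dia (ns_odot ast cur x y) z = ast x (dia y z) + ast y (dia x z);
  nspoisson_bul_odot : forall x y z,
    bul x (ns_odot ast cur y z) + dia x (cur y z)
    = cur (ns_bracket dia bul x y) z + ast z (bul x y)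
      + cur y (ns_bracket dia bul x z) + ast y (bul x z)
}.

End Definitions.

(* Main.v *)
Require Import Defs.
From HB Require Import structures.
From mathcomp Require Import all_boot all_algebra.

Set Implicit Arguments.
Unset Strict Implicit.
Unset Printing Implicit Defensive.

Import GRing.Theory.
Local Open Scope ring_scope.

(** A Nijenhuis operator [N] for a product [f] is a morphism from the deformed
    product [f_N x y = f (N x) y + f x (N y) - N (f x y)] to [f], and the total
    operations of the four operations at stake are exactly the deformations of
    [mul] and [br] ([ns_odot_deformed], [ns_bracket_deformed]).  This settles
    the four identities that the actions [mul (N x)] and [br (N x)] must
    satisfy: once [N (f_N x y)] is replaced by [f (N x) (N y)], they are
    associativity, Leibniz or Jacobi, evaluated with two arguments in
    the image of [N].

    The three remaining identities involve [- N (f x y)], and come from one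
    computation ([curvature_term]).  If [N] is Nijenhuis for [f], then for
    every product [g]
      [- N (f x (g_N y z)) + f (N x) (- N (g y z)) = - N (dT x y z)],
    where [T x y z = f x (g y z)] and [dT] inserts [N] in each argument of [T]
    in turn and subtracts [N] of the value ([ternary_deformed]).  The operator
    [d] is additive in [T] and commutes with permutations of the arguments, so
    it preserves every multilinear identity between ternary composites.  The
    three identities are thus the images under [- N d] of the left-commutative
    law [x (y z) = y (x z)], of Jacobi, and of Leibniz. *)

Section Bilinear.

Variables (k : fieldType) (A : lmodType k) (op : A -> A -> A).
Hypothesis op_bilin : is_bilinear op.

Lemma bilinear_subl x y z : op (x - y) z = op x z - op y z.
Proof. exact: zmod_morphism_linear (op_bilin.1 z) x y. Qed.

Lemma bilinear_subr x y z : op x (y - z) = op x y - op x z.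
Proof. exact: zmod_morphism_linear (op_bilin.2 x) y z. Qed.

Lemma bilinear_oppl x y : op (- x) y = - op x y.
Proof. by rewrite -sub0r -(subrr x) !bilinear_subl subrr sub0r. Qed.

Lemma bilinear_oppr x y : op x (- y) = - op x y.
Proof. by rewrite -sub0r -(subrr y) !bilinear_subr subrr sub0r. Qed.

Lemma bilinear_addl x y z : op (x + y) z = op x z + op y z.
Proof. by rewrite -{1}[y]opprK bilinear_subl bilinear_oppl opprK. Qed.

Lemma bilinear_addr x y z : op x (y + z) = op x y + op x z.
Proof. by rewrite -{1}[z]opprK bilinear_subr bilinear_oppr opprK. Qed.

Lemma bilinear_precomp (N : {linear A -> A}) :
  is_bilinear (fun x y => op (N x) y).
Proof.
split=> [y a u v | x]; last exact: op_bilin.2.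
by rewrite linearP; apply: op_bilin.1.
Qed.

Lemma bilinear_opp_postcomp (N : {linear A -> A}) :
  is_bilinear (fun x y => - N (op x y)).
Proof.
split=> [y | x] a u v; last by rewrite op_bilin.2 linearP opprD -scalerN.
have -> : op (a *: u + v) y = a *: op u y + op v y by apply: op_bilin.1.
by rewrite linearP opprD -scalerN.
Qed.

End Bilinear.

Section Deformation.

Variables (k : fieldType) (A : lmodType k) (N : {linear A -> A}).
Implicit Types (f g mul br : A -> A -> A) (T : A -> A -> A -> A).

Definition deformed f x y := f (N x) y + f x (N y) - N (f x y).

(** The analogue of [deformed] for ternary maps.  It is defined on arbitrary
    maps, rather than on composites of two products, so that one can rewrite
    inside it with an identity such as Jacobi or Leibniz. *)
Definition ternary_deformed T x y z :=
  T (N x) y z + T x (N y) z + T x y (N z) - N (T x y z).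

Lemma eq_ternary_deformed T T' x y z :
  (forall u v w, T u v w = T' u v w) ->
  ternary_deformed T x y z = ternary_deformed T' x y z.
Proof. by move=> eqT; rewrite /ternary_deformed !eqT. Qed.

Lemma ternary_deformedD T T' x y z :
  ternary_deformed (fun u v w => T u v w + T' u v w) x y z =
  ternary_deformed T x y z + ternary_deformed T' x y z.
Proof.
rewrite /ternary_deformed linearD opprD.
by rewrite [RHS](AC (4*4) ((1*5)*(2*6)*(3*7)*(4*8))).
Qed.

Lemma ternary_deformed_swap T x y z :
  ternary_deformed (fun u v w => T v u w) x y z = ternary_deformed T y x z.
Proof. by rewrite /ternary_deformed [T y _ _ + _]addrC. Qed.

Lemma ternary_deformed_rot T x y z :
  ternary_deformed (fun u v w => T v w u) x y z = ternary_deformed T y z x.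
Proof. by rewrite /ternary_deformed [RHS](ACl (3*1*2*4)). Qed.

(** The Nijenhuis identity for the pair [x], [g y z] produces
    [f x (N (g y z))], which cancels the correction term of [deformed g y z];
    what is left is symmetric in the three places where [N] may act. *)
Lemma curvature_term f g x y z :
  is_bilinear f ->
  (forall u v, f (N u) (N v) = N (deformed f u v)) ->
  - N (f x (deformed g y z)) + f (N x) (- N (g y z)) =
  - N (ternary_deformed (fun u v w => f u (g v w)) x y z).
Proof.
move=> f_bilin f_nij.
rewrite (bilinear_oppr f_bilin) f_nij -opprD -linearD; congr (- (N _)).
rewrite /deformed /ternary_deformed (bilinear_subr f_bilin).
rewrite (bilinear_addr f_bilin).
by rewrite [LHS](AC (3*3) (4*1*2*6*(3*5))) /= addNr addr0.
Qed.

Lemma ns_odot_deformed f x y :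
  commutative f ->
  ns_odot (fun u v => f (N u) v) (fun u v => - N (f u v)) x y =
  deformed f x y.
Proof. by move=> fC; rewrite /ns_odot /deformed [f (N y) x]fC. Qed.

Lemma ns_bracket_deformed f x y :
  skew_symmetric f ->
  ns_bracket (fun u v => f (N u) v) (fun u v => - N (f u v)) x y =
  deformed f x y.
Proof. by move=> fN; rewrite /ns_bracket /deformed [f (N y) x]fN opprK. Qed.

(** Jacobi, solved for the term with a bracket on the left: the Nijenhuis
    identity rewrites [br (N x) (N y)] precisely in that position. *)
Lemma lie_ad_bracket br x y z :
  is_lie_bracket br -> br (br x y) z = br x (br y z) - br y (br x z).
Proof.
case=> br_bilin brN jacobi.
have := jacobi x y z.
rewrite (brN z x) (bilinear_oppr br_bilin) (brN z (br x y)).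
by move/eqP; rewrite subr_eq0 => /eqP <-.
Qed.

Lemma poisson_leibnizl mul br x y z :
  is_poisson_algebra mul br ->
  br (mul x y) z = mul x (br y z) + mul y (br x z).
Proof.
case=> -[mul_bilin mulC _] [_ brN _] leibniz.
rewrite brN leibniz (brN z x) (brN z y) [mul (- _) y]mulC.
by rewrite !(bilinear_oppr mul_bilin) -opprD opprK addrC.
Qed.

Lemma nijenhuis_ns_commutative mul :
  is_comm_assoc_algebra mul ->
  (forall x y, mul (N x) (N y) = N (deformed mul x y)) ->
  is_ns_commutative_algebra
    (fun x y => mul (N x) y) (fun x y => - N (mul x y)).
Proof.
case=> mul_bilin mulC mulA mul_nij; split.
- exact: bilinear_precomp.
- exact: bilinear_opp_postcomp.
- by move=> x y; rewrite mulC.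
- by move=> x y z; rewrite ns_odot_deformed // -mul_nij mulA.
move=> x y z; rewrite !ns_odot_deformed // ![mul (N _) _ + _]addrC.
rewrite !curvature_term // -[X in _ = - N X]ternary_deformed_swap.
congr (- (N _)); apply: eq_ternary_deformed => u v w.
by rewrite !mulA [mul u v]mulC.
Qed.

Lemma nijenhuis_ns_lie br :
  is_lie_bracket br ->
  (forall x y, br (N x) (N y) = N (deformed br x y)) ->
  is_ns_lie_algebra (fun x y => br (N x) y) (fun x y => - N (br x y)).
Proof.
move=> br_lie br_nij; case: (br_lie) => br_bilin brN jacobi; split.
- exact: bilinear_precomp.
- exact: bilinear_opp_postcomp.
- by move=> x y; rewrite brN linearN.
- move=> x y z.
  have := lie_ad_bracket (N x) (N y) z br_lie.
  rewrite br_nij -ns_bracket_deformed // /ns_bracket.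
  rewrite linearD linearB (bilinear_addl br_bilin) (bilinear_subl br_bilin).
  move=> ad; rewrite [LHS](ACl (1*3*(2*4))) /= -ad.
  by rewrite [LHS](AC (3*2) ((1*4)*(2*5)*3)) /= subrr addNr !add0r.
move=> x y z; rewrite !ns_bracket_deformed //.
rewrite (ACl ((1*4)*(2*5)*(3*6))) /=.
rewrite !curvature_term // -!opprD -!linearD.
rewrite -(ternary_deformed_rot _ x) -ternary_deformedD.
rewrite -(ternary_deformed_rot _ y) -(ternary_deformed_rot _ x).
rewrite -ternary_deformedD.
rewrite (@eq_ternary_deformed _ (fun _ _ _ => 0)) //.
by rewrite /ternary_deformed linear0 !addr0 subr0 linear0 oppr0.
Qed.

End Deformation.

Theorem proposition3p4 (k : fieldType) (char_k : [pchar k] =i pred0)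
    (A : lmodType k) (mul br : A -> A -> A) (N : {linear A -> A}) :
  is_poisson_algebra mul br ->
  is_nijenhuis mul br N ->
  is_ns_poisson_algebra
    (fun x y => mul (N x) y)
    (fun x y => - N (mul x y))
    (fun x y => br (N x) y)
    (fun x y => - N (br x y)).
Proof.
move=> poisson [mul_nij br_nij].
case: (poisson) => mul_alg br_lie leibniz.
case: (mul_alg) => mul_bilin mulC mulA; case: (br_lie) => br_bilin brN _.
split.
- exact: nijenhuis_ns_commutative.
- exact: nijenhuis_ns_lie.
- by move=> x y z; rewrite ns_bracket_deformed // -br_nij leibniz addrK.
- move=> x y z; rewrite ns_odot_deformed // -mul_nij.
  by rewrite (poisson_leibnizl _ _ _ poisson).
move=> x y z; rewrite ns_odot_deformed // !ns_bracket_deformed //.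
(* Moving [z] to the front puts every term in the shape of [curvature_term]. *)
rewrite [mul (deformed N br x y) z]mulC -[RHS]addrA !curvature_term //.
rewrite -opprD -linearD; congr (- (N _)).
rewrite -(ternary_deformed_swap N _ x y z).
rewrite -(ternary_deformed_rot N _ y z x) -(ternary_deformed_rot N _ x y z).
rewrite -ternary_deformedD; apply: eq_ternary_deformed => u v w.
by rewrite leibniz [mul (br u v) w]mulC.
Qed.
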